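(* Let $0<\alpha<1$, $1<p<\frac1\alpha$ and $\frac1q=\frac1p-\alpha$. If $\omega\in\mathcal{A}(p,q)$, then there exists a positive constant $C$, independent of $x$, such that for every $x\in l^p_{\omega^p}$ one has $I_\alpha x\in l^q_{\omega^q}$ and $$\Big(\sum_{k\in\mathbb{Z}}|I_\alpha x(k)\,\omega(k)|^q\Big)^{\frac1q}\le C\Big(\sum_{k\in\mathbb{Z}}|x(k)\,\omega(k)|^p\Big)^{\frac1p}.$$
   Context: Sequences are real, $x=\{x(k)\}_{k\in\mathbb{Z}}\subset\mathbb{R}$. A discrete weight is a sequence $\omega=\{\omega(k)\}_{k\in\mathbb{Z}}$ of positive reals; powers $\omega^r$ are taken pointwise. For a weight $v$ and $1\le p<\infty$, $l^p_v$ is the space of sequences with $\|x\|_{l^p_v}:=\big(\sum_{k\in\mathbb{Z}}|x(k)|^pv(k)\big)^{1/p}<\infty$. An interval $J\subset\mathbb{Z}$ is a finite nonempty set of consecutive integers, and $|J|$ is its cardinality. For $1<p,q<\infty$ and $p'=p/(p-1)$, $\omega\in\mathcal{A}(p,q)$ means $$\sup_{J}\Big(\frac1{|J|}\sum_{k\in J}\omega(k)^q\Big)^{\frac1q}\Big(\frac1{|J|}\sum_{k\in J}\omega(k)^{-p'}\Big)^{\frac1{p'}}<\infty,$$ the supremum being over all intervals $J\subset\mathbb{Z}$. Discrete Riesz potential: $I_\alpha x(k):=\sum_{i\in\mathbb{Z}\setminus\{k\}}\frac{x(i)}{|k-i|^{1-\alpha}}$, $k\in\mathbb{Z}$. *)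

(* Defs.v *)
From HB Require Import structures.
From mathcomp Require Import all_boot all_order all_algebra.
From mathcomp Require Import all_classical all_reals all_analysis.

Set Implicit Arguments.
Unset Strict Implicit.
Unset Printing Implicit Defensive.

Import Order.TTheory GRing.Theory Num.Theory.

Local Open Scope classical_set_scope.
Local Open Scope ring_scope.

(* Two-sided real sequences are functions [int -> R]. *)

Definition weight (R : realType) (w : int -> R) : Prop := forall k, 0 < w k.

Definition wpow (R : realType) (w : int -> R) (r : R) : int -> R :=
  fun k => w k `^ r.

Definition lp_norm (R : realType) (p : R) (v x : int -> R) : \bar R :=
  ((\esum_(k in [set: int]) (`|x k| `^ p * v k)%:E) `^ p^-1)%E.

Definition lp_space (R : realType) (p : R) (v : int -> R) : set (int -> R) :=
  [set x | (lp_norm p v x < +oo)%E].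

(* The mean of [f] over the interval {a, a + 1, ..., a + n}, of cardinality
   n + 1; every interval of Z arises from exactly one pair (a, n). *)
Definition interval_mean (R : realType) (f : int -> R) (a : int) (n : nat) : R :=
  (n.+1%:R)^-1 * \sum_(i < n.+1) f (a + i%:Z).

Definition conj_exp (R : realType) (p : R) : R := p / (p - 1).

Definition Apq (R : realType) (p q : R) (w : int -> R) : Prop :=
  (ereal_sup [set ((interval_mean (wpow w q) J.1 J.2) `^ q^-1 *
                   (interval_mean (wpow w (- conj_exp p)) J.1 J.2)
                     `^ (conj_exp p)^-1)%:E
             | J in [set: int * nat]] < +oo)%E.

(* [esum] is a supremum of finite partial sums, hence only meaningful for
   nonnegative families. A real family is summed through its positive and
   negative parts; the value is the sum of the series when the family is
   [summable], and carries no meaning otherwise. *)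
Definition real_sum (R : realType) (T : choiceType) (D : set T) (f : T -> R) : R :=
  fine (\esum_(i in D) ((EFin \o f)^\+ i) - \esum_(i in D) ((EFin \o f)^\- i))%E.

Definition riesz_term (R : realType) (alpha : R) (x : int -> R) (k i : int) : R :=
  x i / (`|k - i|%:~R `^ (1 - alpha)).

Definition riesz_potential (R : realType) (alpha : R) (x : int -> R) : int -> R :=
  fun k => real_sum (~` [set k]) (riesz_term alpha x k).

Definition riesz_defined (R : realType) (alpha : R) (x : int -> R) : Prop :=
  forall k, summable (~` [set k]) (EFin \o riesz_term alpha x k).

(* Main.v *)
Require Import Defs.
From HB Require Import structures.
From mathcomp Require Import all_boot all_order all_algebra.
From mathcomp Require Import all_classical all_reals all_analysis.
From mathcomp Require Import ring lra zify.

(* The weight condition is self-dual: with u = w^q and sg = w^(-p'), Hoelder's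
   inequality turns it into |J|^(1-alpha) ~ u(J)^(1/q) sg(J)^(1/p') for every
   interval J, and forces u(J') >= (1+delta) u(J) whenever J' contains J and is
   at least twice as long.  Write |x| = g sg.  The term |J|^(alpha-1) sum_J |x|
   is at most a multiple of ||x||_p u(J)^(-1/q), by Hoelder, and of V(k) u(J)^alpha
   for k in J, where V is built from a maximal function with respect to sg
   followed by one with respect to u, and sum_k V(k)^p u(k) <= C ||x||_p^p.
   Summing over the balls of radius 8^n around k, the two bounds form geometric
   series meeting where u(J)^(1/p) = ||x||_p / V(k) (Hedberg's argument), whence
   |I_alpha x(k)| <= C V(k)^(p/q) ||x||_p^(1-p/q).  The q-th powers then sum.
   All this happens on windows of length 8^N, uniformly in N. *)

Set Implicit Arguments.
Unset Strict Implicit.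
Unset Printing Implicit Defensive.

Import Order.TTheory GRing.Theory Num.Theory.

Local Open Scope classical_set_scope.
Local Open Scope ring_scope.

(** * Elementary facts on powers and finite sums *)

Lemma powR_expR (R : realType) (x e : R) : 0 < x -> x `^ e = expR (e * ln x).
Proof. by move=> x0; rewrite /powR gt_eqF. Qed.

Lemma sum_nat_gt0 (R : numDomainType) (f : nat -> R) (s t : nat) :
  (forall i, 0 < f i) -> (s < t)%N -> 0 < \sum_(s <= i < t) f i.
Proof.
by move=> f0 st; rewrite big_ltn// ltr_wpDr// sumr_ge0// => i _; exact: ltW.
Qed.

Lemma le_sum_subinterval (R : numDomainType) (f : nat -> R) (s a b t : nat) :
  (forall i, 0 <= f i) -> (s <= a)%N -> (a <= b)%N -> (b <= t)%N ->
  \sum_(a <= i < b) f i <= \sum_(s <= i < t) f i.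
Proof.
move=> f0 sa ab bt.
rewrite (@big_cat_nat _ _ _ a s t)//=; last exact: leq_trans bt.
rewrite (@big_cat_nat _ _ _ b a t)//=.
by rewrite addrCA ler_wpDr// addr_ge0// sumr_ge0.
Qed.

(** * Maximal inequality for an arbitrary positive measure *)

(** Discrete rising sun argument. If the first index [s] is selected, take the least [t] for which
    the sum over [[s, t)] is nonnegative: the whole block [[s, t)] is then selected and has
    nonnegative sum, and induction handles what lies beyond [t]. *)
Lemma rising_sun (R : realDomainType) (d : nat -> R) (L s : nat) :
  0 <= \sum_(s <= k < L |
         has (fun t => 0 <= \sum_(k <= i < t) d i) (index_iota k.+1 L.+1)) d k.
Proof.
pose P k := has (fun t => 0 <= \sum_(k <= i < t) d i) (index_iota k.+1 L.+1).
change (0 <= \sum_(s <= k < L | P k) d k).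
have [n] := ubnP (L - s)%N; elim: n s => // n IH s.
rewrite ltnS => Ln.
have [Ls|sL] := leqP L s; first by rewrite big_geq.
have IHs t : (s < t)%N -> 0 <= \sum_(t <= k < L | P k) d k.
  by move=> st; apply: IH; lia.
have [Ps|nPs] := boolP (P s); last by rewrite big_ltn_cond// (negbTE nPs) IHs.
pose Q t := [&& (s < t)%N, (t <= L)%N & 0 <= \sum_(s <= i < t) d i].
have exQ : exists t, Q t.
  by move: Ps => /hasP[t]; rewrite mem_index_iota ltnS => /andP[? ?] ?;
     exists t; apply/and3P.
case: (ex_minnP exQ) => t /and3P[st tL d0] tmin.
rewrite (@big_cat_nat _ _ _ t)/= ?(ltnW st)// addr_ge0// ?IHs//.
rewrite (_ : \sum_(s <= i < t | P i) d i = \sum_(s <= i < t) d i)//.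
rewrite [LHS]big_nat_cond [RHS]big_nat; apply: eq_bigl => k.
rewrite andbC andb_idl// => /andP[sk kt].
apply/hasP; exists t; first by rewrite mem_index_iota; lia.
have [->//|ns] := eqVneq k s.
(* Minimality of [t] makes the sum over [[s, k)] negative, so the sum over [[k, t)] is positive. *)
have : ~~ Q k by apply: contraL kt => /tmin; rewrite -leqNgt.
rewrite /Q !negb_and -!ltNge -!leqNgt.
move=> /orP[|/orP[]]; [lia|lia|move=> dk].
by move: d0; rewrite (@big_cat_nat _ _ _ k)//= ?(ltnW kt)//; lra.
Qed.

(* Young's inequality for [x * y `^ (r - 1)]. *)
Lemma powR_sub_le (R : realType) (r x y : R) : 1 < r -> 0 <= y -> y <= x ->
  x `^ r - y `^ r <= r / (r - 1) * (x * (x `^ (r - 1) - y `^ (r - 1))).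
Proof.
move=> r1 y0 yx; have x0 : 0 <= x by exact: le_trans yx.
have r10 : 0 < r - 1 by lra.
have := @conjugate_powR R x (y `^ (r - 1)) r (r / (r - 1)) x0 (powR_ge0 _ _).
rewrite -powRrM (_ : (r - 1) * (r / (r - 1)) = r); last by field; lra.
move=> /(_ ltac:(lra) (divr_gt0 _ _))/=.
have -> : r^-1 + (r / (r - 1))^-1 = 1 by field; apply/andP; split; lra.
move=> /(_ ltac:(lra) r10 erefl) H.
rewrite mulrBr (mulr_powRB1 x0 (lt_trans ltr01 r1)).
have -> : x `^ r - y `^ r = r / (r - 1) * (x `^ r -
   (x `^ r / r + y `^ r / (r / (r - 1)))) by field; apply/andP; split; lra.
rewrite ler_pM2l ?divr_gt0//; lra.
Qed.

(** Integration of the weak-type bound over levels, as in Doob's inequality, done with finite sums: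
    only the values taken by [m] matter as levels, and [powR_sub_le] compares the increments of the
    two powers between consecutive levels. *)
Lemma layer_cake_le (R : realType) (I : finType) (a b m : I -> R) (r : R) :
  1 < r -> (forall i, 0 <= m i) ->
  (forall v : R, 0 < v ->
     v * \sum_(i | v <= m i) a i <= \sum_(i | v <= m i) b i) ->
  (forall i, 0 <= a i) ->
  \sum_i a i * m i `^ r <= r / (r - 1) * \sum_i b i * m i `^ (r - 1).
Proof.
move=> r1 m0 weak a0; have r10 : 0 < r - 1 by lra.
have c0 : 0 < r / (r - 1) by apply: divr_gt0; lra.
(* Truncation at a level [c] allows induction on the number of indices above [c]; each round strips
   the lowest remaining level. The goal is the case [c = 0]. *)
suff H (c : R) : 0 <= c -> \sum_(i | c < m i) a i * (m i `^ r - c `^ r) <=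
    r / (r - 1) * \sum_(i | c < m i) b i * (m i `^ (r - 1) - c `^ (r - 1)).
  have := H 0 (lexx _).
  have Z (f : I -> R) (t : R) : 0 < t ->
     \sum_(i | 0 < m i) f i * (m i `^ t - 0 `^ t) = \sum_i f i * m i `^ t.
    move=> t0; rewrite [RHS](bigID (fun i => 0 < m i))/=.
    rewrite [X in _ = _ + X]big1 ?addr0.
      by apply: eq_bigr => i _; rewrite powR0 ?subr0//; lra.
    move=> i; rewrite -leNgt => mi; have -> : m i = 0 by have := m0 i; lra.
    by rewrite powR0 ?mulr0//; lra.
  by rewrite !Z//; lra.
have [n] := ubnP #|[pred i | c < m i]|; elim: n c => // n IH c.
rewrite ltnS => cn c0'.
have [|] := eqVneq #|[pred i | c < m i]| 0%N.
  move/card0_eq => E; have E' i : (c < m i) = false by exact: (E i).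
  by rewrite !big_pred0 ?mulr0.
rewrite -lt0n => /card_gt0P[i0 ci0].
case: (@arg_minP _ _ _ i0 [pred i | c < m i] m ci0) => j cj jmin.
set v := m j.
have v0 : 0 < v by exact: le_lt_trans cj.
(* [v] is the least value of [m] above [c], so the strict level set at [c] is the one appearing in
   the weak inequality at [v]. *)
have vE i : (c < m i) = (v <= m i).
  by apply/idP/idP => [/jmin//|]; exact: lt_le_trans.
have split_at (f : I -> R) t :
    \sum_(i | c < m i) f i * (m i `^ t - c `^ t) =
    \sum_(i | v < m i) f i * (m i `^ t - v `^ t) +
    (v `^ t - c `^ t) * \sum_(i | v <= m i) f i.
  rewrite mulr_sumr (eq_bigl _ _ vE).
  rewrite (_ : \sum_(i | v < m i) _ =
     \sum_(i | v <= m i) f i * (m i `^ t - v `^ t)); last first.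
    rewrite [RHS](bigID (fun i => v < m i))/= [X in _ = _ + X]big1.
      rewrite addr0; apply: eq_bigl => i.
      by rewrite andbC andb_idr// => /ltW.
    move=> i /andP[vi]; rewrite -leNgt => iv.
    by rewrite (_ : m i = v) ?subrr ?mulr0//; apply/le_anti; rewrite iv vi.
  by rewrite -big_split/=; apply: eq_bigr => i _; ring.
rewrite !split_at mulrDr lerD//.
  apply: IH; last exact: ltW.
  apply: leq_trans cn; apply: proper_card; apply/properP; split.
    by apply/fintype.subsetP => i; rewrite !inE; exact: lt_trans.
  by exists j; rewrite !inE// ltxx.
have Q := powR_sub_le r1 c0' (ltW cj : c <= v).
have S0 : 0 <= \sum_(i | v <= m i) a i by apply: sumr_ge0.
apply: le_trans (ler_wpM2r S0 Q) _.
rewrite -[leLHS]mulrA ler_pM2l// mulrAC mulrC ler_wpM2l ?weak//.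
by rewrite subr_ge0 ge0_ler_powR ?nnegrE//; [lra|exact: ltW|exact: ltW].
Qed.

(** The maximal average over intervals starting at [k] satisfies the weak inequality with constant
    one: its level set [v <= m] is exactly the set selected in [rising_sun] for the sequence
    [g * mu - v * mu]. Then [layer_cake_le] and absorption give a constant depending on [r]
    alone. *)
Lemma right_maximal_le (R : realType) (r : R) : 1 < r ->
  exists2 C : R, 0 < C &
  forall (L : nat) (mu g : nat -> R),
    (forall i, 0 < mu i) -> (forall i, 0 <= g i) ->
  exists m : nat -> R, [/\ forall k, 0 <= m k,
    forall k t, (k < t)%N -> (t <= L)%N ->
      \sum_(k <= i < t) g i * mu i <= m k * \sum_(k <= i < t) mu i &
    \sum_(0 <= k < L) m k `^ r * mu k <= C * \sum_(0 <= k < L) g k `^ r * mu k].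
Proof.
move=> r1; have r10 : 0 < r - 1 by lra.
have : 0 < r / (r - 1) by apply: divr_gt0; lra.
set r' := r / (r - 1); move=> r'0.
exists (2 * (2 * r') `^ r); first by rewrite mulr_gt0 ?powR_gt0//; lra.
move=> L mu g mu0 g0.
pose av k t := (\sum_(k <= i < t) g i * mu i) / \sum_(k <= i < t) mu i.
pose m k := \big[Num.max/0]_(k.+1 <= t < L.+1) av k t.
have mass_gt0 k t : (k < t)%N -> 0 < \sum_(k <= i < t) mu i.
  exact: sum_nat_gt0.
have m0 k : 0 <= m k by exact: bigmax_ge_id.
exists m; split => //.
  move=> k t kt tL; rewrite -ler_pdivrMr ?mass_gt0//.
  apply: (@le_bigmax_seq _ R _ (index_iota k.+1 L.+1) 0 t xpredT (av k)) => //.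
  by rewrite mem_index_iota kt.
have weak (v : R) : 0 < v ->
    v * \sum_(i < L | v <= m i) mu i <= \sum_(i < L | v <= m i) g i * mu i.
  move=> v0; rewrite mulr_sumr -subr_ge0 -sumrB.
  have := rising_sun (fun i => g i * mu i - v * mu i) L 0.
  rewrite big_mkord; set P := (X in \sum_(i < L | X i) _) => H.
  rewrite (eq_bigl (fun i : 'I_L => P i))//= => k.
  have E t : t \in index_iota k.+1 L.+1 ->
     (0 <= \sum_(k <= i < t) (g i * mu i - v * mu i)) = (v <= av k t).
    rewrite mem_index_iota => /andP[kt tL].
    by rewrite sumrB -mulr_sumr subr_ge0 ler_pdivlMr ?mass_gt0.
  apply/idP/hasP => [vm|[t tk]].
    apply: contrapT => nex.
    suff : m k < v by rewrite ltNge vm.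
    rewrite /m big_nat; apply: bigmax_lt => // t tkL.
    rewrite ltNge; apply/negP => vt; apply: nex.
    by exists t; rewrite ?E ?mem_index_iota.
  rewrite E// => vt; apply: le_trans vt _.
  exact: (@le_bigmax_seq _ R _ (index_iota k.+1 L.+1) 0 t xpredT (av k)).
have := layer_cake_le r1 (fun i : 'I_L => m0 i) weak (fun i => ltW (mu0 i)).
rewrite -/r' !big_mkord => H.
(* Absorb: either [2 r' g <= m], or [m^(r-1)] is dominated by a power of [g]. *)
have pt (i : 'I_L) : r' * (g i * mu i * m i `^ (r - 1)) <=
    2^-1 * (mu i * m i `^ r) + (2 * r') `^ r * (g i `^ r * mu i).
  rewrite (_ : r' * _ = (r' * g i * m i `^ (r - 1)) * mu i); last by ring.
  rewrite (_ : _ + _ = (2^-1 * m i `^ r + (2 * r') `^ r * g i `^ r) * mu i);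
    last by ring.
  rewrite ler_pM2r// -powRM//; last by lra.
  have [le|lt] := leP (2 * r' * g i) (m i).
    apply: ler_wpDr; first exact: powR_ge0.
    rewrite -(mulr_powRB1 (m0 i) (lt_trans ltr01 r1)) mulrA ler_wpM2r ?powR_ge0//; lra.
  have rg0 : 0 <= 2 * r' * g i by apply: mulr_ge0 => //; lra.
  apply: ler_wpDl; first by rewrite mulr_ge0 ?powR_ge0 ?invr_ge0 ?ler0n.
  rewrite -(mulr_powRB1 rg0 (lt_trans ltr01 r1)).
  apply: ler_pM; first by rewrite mulr_ge0// ltW.
  - exact: powR_ge0.
  - by have := mulr_ge0 (ltW r'0) (g0 i); lra.
  - by apply: ge0_ler_powR; rewrite ?nnegrE//; [exact: ltW|exact: ltW].
have := ler_sum (index_enum 'I_L) (fun i (_ : true) => pt i).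
rewrite -mulr_sumr big_split/= -!mulr_sumr => H2.
rewrite (eq_bigr (fun i : 'I_L => mu i * m i `^ r)); last by move=> i _; ring.
lra.
Qed.

(** An interval containing [k] is the union of a part ending at [k] and a part starting at [k]. The
    second is covered by [right_maximal_le], the first by its mirror image under [i] to
    [L.-1 - i]. *)
Lemma maximal_le (R : realType) (r : R) : 1 < r ->
  exists2 C : R, 0 < C &
  forall (L : nat) (mu g : nat -> R),
    (forall i, 0 < mu i) -> (forall i, 0 <= g i) ->
  exists m : nat -> R, [/\ forall k, 0 <= m k,
    forall s k t, (s <= k)%N -> (k < t)%N -> (t <= L)%N ->
      \sum_(s <= i < t) g i * mu i <= m k * \sum_(s <= i < t) mu i &
    \sum_(0 <= k < L) m k `^ r * mu k <= C * \sum_(0 <= k < L) g k `^ r * mu k].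
Proof.
move=> r1; have [C C0 HC] := right_maximal_le r1.
exists (2 `^ r * (2 * C)); first by rewrite !mulr_gt0 ?powR_gt0.
move=> L mu g mu0 g0.
have [m1 [m10 m1J m1r]] := HC L mu g mu0 g0.
have [m2 [m20 m2J m2r]] := HC L (fun i => mu (L.-1 - i)%N)
  (fun i => g (L.-1 - i)%N) (fun i => mu0 _) (fun i => g0 _).
have flip (F : nat -> R) a b : (a <= b)%N -> (b <= L)%N ->
    \sum_(a <= i < b) F (L.-1 - i)%N = \sum_(L - b <= i < L - a) F i.
  move=> ab; elim: b ab => [|b IH].
    by rewrite leqn0 => /eqP->; rewrite !big_geq ?subnn.
  rewrite leq_eqVlt => /orP[/eqP-> _|ab bL]; first by rewrite !big_geq.
  rewrite big_nat_recr//= IH ?(ltnW bL)// [RHS]big_ltn; last by lia.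
  rewrite addrC (_ : (L - b.+1).+1 = L - b)%N; last by lia.
  by congr (F _ + _); lia.
exists (fun k => m1 k + m2 (L.-1 - k)%N); split.
- by move=> k; rewrite addr_ge0.
- move=> s k t sk kt tL.
  have := m1J k t kt tL.
  have := m2J (L.-1 - k)%N (L - s)%N ltac:(lia) ltac:(lia).
  rewrite (flip (fun i => g i * mu i)) ?(flip mu); try lia.
  rewrite (_ : (L - (L - s) = s)%N); last by lia.
  rewrite (_ : (L - (L.-1 - k) = k.+1)%N); last by lia.
  move=> HL HR.
  rewrite (@big_cat_nat _ _ _ k)//=; last exact: ltnW.
  have HL' : \sum_(s <= i < k) g i * mu i <= \sum_(s <= i < k.+1) g i * mu i.
    by rewrite big_nat_recr//= lerDl mulr_ge0// ltW.
  apply: le_trans (lerD (le_trans HL' HL) HR) _.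
  rewrite addrC mulrDl; apply: lerD; apply: ler_wpM2l => //.
    by apply: le_sum_subinterval; rewrite ?(ltnW kt)// => i; exact: ltW.
  by apply: le_sum_subinterval; rewrite ?leqW// => i; exact: ltW.
move: m2r; rewrite (flip (fun i => g i `^ r * mu i)) ?leq0n// subn0 subnn.
have -> : \sum_(0 <= k < L) m2 k `^ r * mu (L.-1 - k)%N =
    \sum_(0 <= k < L) m2 (L.-1 - k)%N `^ r * mu k.
  have := flip (fun i => m2 (L.-1 - i)%N `^ r * mu i) 0 L (leq0n _) (leqnn _).
  rewrite subn0 subnn => <-.
  rewrite big_nat [RHS]big_nat; apply: eq_bigr => i /andP[_ iL].
  by rewrite (_ : (L.-1 - (L.-1 - i) = i)%N); last by lia.
move=> m2r.
have pt k : (m1 k + m2 (L.-1 - k)%N) `^ r * mu k <=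
    2 `^ r * (m1 k `^ r * mu k + m2 (L.-1 - k)%N `^ r * mu k).
  rewrite -mulrDl mulrA ler_pM2r//.
  have H a b : 0 <= a -> a <= b -> (a + b) `^ r <= 2 `^ r * (a `^ r + b `^ r).
    move=> a0 ab; have b0 : 0 <= b by exact: le_trans ab.
    apply: (@le_trans _ _ ((2 * b) `^ r)).
      by apply: ge0_ler_powR; rewrite ?nnegrE; lra.
    rewrite powRM// ler_pM2l ?powR_gt0//.
    by have := powR_ge0 a r; lra.
  have [le|/ltW le] := leP (m1 k) (m2 (L.-1 - k)%N); first exact: H.
  by rewrite addrC [X in _ * X]addrC; exact: H.
apply: le_trans (ler_sum _ (fun k _ => pt k)) _.
rewrite -mulr_sumr big_split/= -[leRHS]mulrA ler_pM2l ?powR_gt0//; lra.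
Qed.

(** * Hoelder's inequality and Hedberg's summation *)

(** Young's inequality is applied to [a i / A] and [b i / B]; if [A] or [B] vanishes, so does every
    term. *)
Lemma hoelder_sum (R : realType) (I : eqType) (r : seq I) (P : pred I)
    (a b : I -> R) (t : R) :
  0 < t -> t < 1 -> (forall i, 0 <= a i) -> (forall i, 0 <= b i) ->
  \sum_(i <- r | P i) a i `^ t * b i `^ (1 - t) <=
  (\sum_(i <- r | P i) a i) `^ t * (\sum_(i <- r | P i) b i) `^ (1 - t).
Proof.
move=> t0 t1 a0 b0.
set A := \sum_(i <- r | P i) a i; set B := \sum_(i <- r | P i) b i.
have vanish (f : I -> R) : (forall i, 0 <= f i) ->
    \sum_(i <- r | P i) f i = 0 -> forall i, i \in r -> P i -> f i = 0.
  move=> f0 /eqP; rewrite psumr_eq0// => /allP H i ir Pi.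
  by have := H i ir; rewrite Pi => /eqP.
have [A0|A0] := eqVneq A 0.
  rewrite big_seq_cond big1 ?mulr_ge0 ?powR_ge0// => i /andP[ir Pi].
  by rewrite (vanish a)// powR0 ?mul0r// gt_eqF.
have [B0|B0] := eqVneq B 0.
  rewrite big_seq_cond big1 ?mulr_ge0 ?powR_ge0// => i /andP[ir Pi].
  by rewrite (vanish b)// powR0 ?mulr0// gt_eqF// subr_gt0.
have Ap : 0 < A by rewrite lt_def A0 sumr_ge0.
have Bp : 0 < B by rewrite lt_def B0 sumr_ge0.
have young (x y : R) : 0 <= x -> 0 <= y ->
    x `^ t * y `^ (1 - t) <= t * x + (1 - t) * y.
  move=> x0 y0.
  have := @conjugate_powR R (x `^ t) (y `^ (1 - t)) t^-1 (1 - t)^-1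
    (powR_ge0 _ _) (powR_ge0 _ _).
  rewrite !invrK -!powRrM !mulfV ?powRr1 ?gt_eqF ?subr_gt0// ?invr_gt0.
  rewrite subr_gt0 [x * t]mulrC [y * (1 - t)]mulrC.
  by apply => //; ring.
have pt i : a i `^ t * b i `^ (1 - t) <=
    A `^ t * B `^ (1 - t) * (t * (a i / A) + (1 - t) * (b i / B)).
  have -> : a i `^ t * b i `^ (1 - t) = A `^ t * B `^ (1 - t) *
      ((a i / A) `^ t * (b i / B) `^ (1 - t)).
    rewrite mulrACA -!powRM ?divr_ge0 ?(ltW Ap) ?(ltW Bp)//.
    by rewrite ![_ * (_ / _)]mulrC !divfK.
  by rewrite ler_pM2l ?mulr_gt0 ?powR_gt0// young// divr_ge0// ?(ltW Ap) ?(ltW Bp).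
apply: le_trans (ler_sum _ (fun i _ => pt i)) _.
rewrite -mulr_sumr big_split/= -!mulr_sumr -!mulr_suml -/A -/B !divff//.
by rewrite !mulr1 subrKC mulr1.
Qed.

(* [s / (1 + s)] increases by a fixed multiple of [min s (1 / s)] when [s] is
   multiplied by [rho], so the sum telescopes. *)
Lemma sum_min_geometric (R : realFieldType) (rho : R) (N : nat) (s c : nat -> R) :
  1 < rho -> (forall n, 0 < s n) ->
  (forall n, (n < N)%N -> rho * s n <= s n.+1) ->
  (forall n, (n <= N)%N -> [/\ 0 <= c n, c n <= s n & c n * s n <= 1]) ->
  \sum_(0 <= n < N.+1) c n <= 2 * (1 + rho) / (rho - 1).
Proof.
move=> rho1 s0 sS cs.
pose K : R := 2 * (1 + rho) / (rho - 1).
have K0 : 0 < K by apply: divr_gt0; lra.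
pose phi x : R := x / (1 + x).
have phi_le x y : 0 < x -> x <= y -> phi x <= phi y.
  move=> x0 xy; rewrite -subr_ge0.
  have -> : phi y - phi x = (y - x) / ((1 + x) * (1 + y)).
    by rewrite /phi; field; rewrite !gt_eqF//; lra.
  by rewrite divr_ge0 ?subr_ge0// mulr_ge0//; lra.
have step n : (n <= N)%N -> c n <= K * (phi (rho * s n) - phi (s n)).
  move=> /cs[c0 c1 c2]; have sn := s0 n.
  have -> : K * (phi (rho * s n) - phi (s n)) =
      2 * (1 + rho) * s n / ((1 + s n) * (1 + rho * s n)).
    rewrite /K /phi; field; rewrite !gt_eqF//; nra.
  rewrite ler_pdivlMr; last by apply: mulr_gt0; nra.
  (* Below 1 the bound [c n <= s n] is used, above 1 the bound [c n * s n <= 1]. *)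
  have [s1|s1] := leP (s n) 1.
    apply: le_trans (_ : s n * ((1 + s n) * (1 + rho * s n)) <= _).
      by apply: ler_wpM2r => //; apply: mulr_ge0; nra.
    rewrite [leRHS]mulrC ler_pM2l// ler_pM//; nra.
  have : (1 + s n) * (1 + rho * s n) <= 2 * s n * ((1 + rho) * s n).
    by apply: ler_pM; nra.
  move=> /(ler_wpM2l c0) H; apply: le_trans H _.
  rewrite (_ : c n * _ = (c n * s n) * (2 * (1 + rho) * s n)); last by ring.
  by rewrite -[leRHS]mul1r ler_wpM2r// !mulr_ge0//; lra.
suff H n : (n <= N)%N -> \sum_(0 <= i < n.+1) c i <= K * phi (rho * s n).
  apply: le_trans (H N (leqnn _)) _; rewrite -/K -[leRHS]mulr1 ler_pM2l//.
  have := mulr_gt0 (lt_trans ltr01 rho1) (s0 N).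
  by rewrite /phi => h; rewrite ler_pdivrMr; lra.
elim: n => [_|n IH nN].
  rewrite big_nat1; apply: le_trans (step 0%N (leq0n _)) _.
  rewrite ler_pM2l// gerBl /phi divr_ge0//; have := s0 0%N; lra.
rewrite big_nat_recr//=; apply: le_trans (lerD (IH (ltnW nN)) (step _ nN)) _.
rewrite -mulrDr ler_pM2l//.
have : phi (rho * s n) <= phi (s n.+1).
  by apply: phi_le; rewrite ?sS// mulr_gt0//; lra.
lra.
Qed.

(** One bound increases with [r n], the other decreases. Rescaling [r] by the point where they
    cross, and [c] by their common value there, reduces the sum to [sum_min_geometric]. *)
Lemma sum_min_powR (R : realType) (a b rho : R) : 0 < a -> 0 < b -> 1 < rho ->
  exists2 K : R, 0 < K &
  forall (N : nat) (r c : nat -> R) (x y : R), 0 <= x -> 0 <= y ->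
    (forall n, 0 < r n) ->
    (forall n, (n < N)%N -> rho * r n <= r n.+1) ->
    (forall n, (n <= N)%N ->
      [/\ 0 <= c n, c n <= x * r n `^ a & c n <= y * r n `^ (- b)]) ->
  \sum_(0 <= n < N.+1) c n <= K * (x `^ (b / (a + b)) * y `^ (a / (a + b))).
Proof.
move=> a0 b0 rho1.
(* With this exponent, [z^a <= z^d] for [z <= 1] and [z^(-b) <= z^(-d)] for [z >= 1], so one power
   serves both regimes. *)
pose d := Num.min a b.
have d0 : 0 < d by rewrite lt_min a0.
have p1 e : (1 : R) `^ e = 1 by rewrite powR1.
have rhod : 1 < rho `^ d.
  have := @gt0_ltr_powR R d d0 1 rho; rewrite /= powR1 !nnegrE.
  by apply; lra.
exists (2 * (1 + rho `^ d) / (rho `^ d - 1)).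
  by apply: divr_gt0; lra.
move=> N r c x y; rewrite le0r => /predU1P[->|x0].
  move=> _ r0 _ cr; rewrite big_nat big1.
    by rewrite !mulr_ge0 ?powR_ge0 ?invr_ge0//; lra.
  by move=> n /andP[_ nN]; have [? + _] := cr n nN; rewrite mul0r; lra.
rewrite le0r => /predU1P[->|y0].
  move=> r0 _ cr; rewrite big_nat big1.
    by rewrite !mulr_ge0 ?powR_ge0 ?invr_ge0//; lra.
  by move=> n /andP[_ nN]; have [? _ +] := cr n nN; rewrite mul0r; lra.
move=> r0 rS cr.
set T := x `^ _ * y `^ _.
have T0 : 0 < T by rewrite mulr_gt0 ?powR_gt0.
(* The crossing point: [x * v^a = y * v^(-b) = T]. *)
pose v := (y / x) `^ (a + b)^-1.
have v0 : 0 < v by rewrite powR_gt0// divr_gt0.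
have lnv : ln v = (a + b)^-1 * (ln y - ln x).
  by rewrite ln_powR ln_div.
have xT : x = T * v `^ (- a).
  rewrite /T !powR_expR// lnv -!expRD -[LHS]lnK ?posrE//; congr expR.
  field; lra.
have yT : y = T * v `^ b.
  rewrite /T !powR_expR// lnv -!expRD -[LHS]lnK ?posrE//; congr expR.
  field; lra.
rewrite mulrC -ler_pdivrMl// mulrC mulr_suml.
apply: (@sum_min_geometric _ _ _ (fun n => (r n / v) `^ d)) => //.
- by move=> n; rewrite powR_gt0// divr_gt0.
- move=> n nN; have rv0 m : 0 <= r m / v by rewrite divr_ge0 ?ltW.
  rewrite -powRM//; last by lra.
  apply: ge0_ler_powR; rewrite ?nnegrE ?(ltW d0)//.
  + by rewrite mulr_ge0//; lra.
  + by rewrite mulrA ler_pM2r ?invr_gt0// rS.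
- move=> n nN; have [c0 cx cy] := cr n nN.
  have z0 : 0 < r n / v by rewrite divr_gt0.
  have cT0 : 0 <= c n / T by rewrite divr_ge0// ltW.
  have cx' : c n / T <= (r n / v) `^ a.
    rewrite ler_pdivrMr// (le_trans cx)// {1}xT.
    rewrite powRM ?invr_ge0 ?(ltW v0) ?(ltW (r0 n))//.
    rewrite -[v^-1]powR_inv1 ?(ltW v0)// -powRrM mulN1r.
    by rewrite [leRHS]mulrC mulrA mulrAC.
  have cy' : c n / T <= (r n / v) `^ (- b).
    rewrite ler_pdivrMr// (le_trans cy)// {1}yT.
    rewrite powRM ?invr_ge0 ?(ltW v0) ?(ltW (r0 n))//.
    rewrite -[v^-1]powR_inv1 ?(ltW v0)// -powRrM mulN1r opprK.
    by rewrite [leRHS]mulrC mulrA mulrAC.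
  have [z1|z1] := leP (r n / v) 1.
    have h1 : (r n / v) `^ d <= 1.
      by rewrite -(p1 d); apply: ge0_ler_powR; rewrite ?nnegrE// ltW.
    have h2 : (r n / v) `^ a <= (r n / v) `^ d.
      by apply: ger_powR; rewrite ?z0// ge_min lexx.
    split=> //; first exact: le_trans cx' h2.
    rewrite -[leRHS]mulr1 ler_pM ?powR_ge0//.
    exact: le_trans cx' (le_trans h2 h1).
  have h1 : 1 <= (r n / v) `^ d.
    by rewrite -(p1 d); apply: ge0_ler_powR; rewrite ?nnegrE// ltW.
  have h2 : (r n / v) `^ (- b) <= (r n / v) `^ (- d).
    by apply: ler_powR; [exact: ltW|rewrite lerN2 ge_min lexx orbT].
  have h3 : (r n / v) `^ (- b) * (r n / v) `^ d <= 1.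
    have := ler_wpM2r (powR_ge0 (r n / v) d) h2.
    by rewrite -[X in _ <= X -> _]powRD ?addNr ?powRr0//; rewrite (gt_eqF z0) implybT.
  split=> //.
    apply: le_trans cy' (le_trans _ h1).
    by apply: le_trans h3; rewrite ler_peMr ?powR_ge0.
  by apply: le_trans h3; rewrite ler_wpM2r ?powR_ge0.
Qed.

(** * Consequences of the weight condition *)

(** Hoelder with exponent [b / (b + c)], applied to the factorization of 1 into powers of [u] and
    [sg]. The predicate [P] permits sets that are not intervals, such as the complement of an
    interval in a larger one. *)
Lemma count_le_weights (R : realType) (I : eqType) (r : seq I) (P : pred I)
    (b c : R) (u sg : I -> R) :
  0 < b -> 0 < c -> (forall i, 0 < u i) -> (forall i, 0 < sg i) ->
  (forall i, u i `^ b * sg i `^ c = 1) ->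
  (\sum_(i <- r | P i) 1) `^ (b + c) <=
  (\sum_(i <- r | P i) u i) `^ b * (\sum_(i <- r | P i) sg i) `^ c.
Proof.
move=> b0 c0 u0 sg0 usg.
have bc0 : 0 < b + c by lra.
have th0 : 0 < b / (b + c) by apply: divr_gt0; lra.
have th1 : b / (b + c) < 1 by rewrite ltr_pdivrMr//; lra.
have S0 (f : I -> R) : (forall i, 0 < f i) -> 0 <= \sum_(i <- r | P i) f i.
  by move=> f0; apply: sumr_ge0 => i _; exact: ltW.
have := hoelder_sum r P th0 th1 (fun i => ltW (u0 i)) (fun i => ltW (sg0 i)).
have -> : 1 - b / (b + c) = c / (b + c) by field; lra.
under eq_bigr => i _ do
  rewrite !powRrM -powRM ?powR_ge0// usg powR1.
rewrite !powRrM -powRM ?powR_ge0//.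
set X := _ * _ => H.
have X0 : 0 <= X by rewrite mulr_ge0 ?powR_ge0.
have XE : X = (X `^ (b + c)^-1) `^ (b + c).
  by rewrite -powRrM mulVf ?powRr1// gt_eqF.
rewrite [leRHS]XE.
apply: ge0_ler_powR; rewrite ?nnegrE ?(ltW bc0) ?powR_ge0//.
by apply: (S0 (fun=> 1)) => i; exact: ltr01.
Qed.

(** The A(p,q) condition with the means multiplied out, for [u = w^q], [sg = w^(-p')], [b = 1/q],
    [c = 1/p']. *)
Definition two_weight_bound (R : realType) (b c A : R) (u sg : nat -> R) :=
  forall s t : nat, (s < t)%N ->
    (\sum_(s <= i < t) u i) `^ b * (\sum_(s <= i < t) sg i) `^ c
    <= A * (t - s)%:R `^ (b + c).

(** Reverse doubling. The complement of the small interval holds at least half the points of the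
    large one, so [count_le_weights] bounds its [u]-mass from below; comparison with the weight
    condition on the large interval cancels the [sg]-mass and leaves a fixed fraction of the large
    [u]-mass. *)
Lemma weight_growth (R : realType) (b c A : R) (u sg : nat -> R)
    (s t s' t' : nat) :
  0 < b -> 0 < c -> 0 < A -> (forall i, 0 < u i) -> (forall i, 0 < sg i) ->
  (forall i, u i `^ b * sg i `^ c = 1) -> two_weight_bound b c A u sg ->
  (s' <= s)%N -> (s < t)%N -> (t <= t')%N -> (2 * (t - s) <= t' - s')%N ->
  (1 + (2^-1 `^ (b + c) / A) `^ b^-1) * \sum_(s <= i < t) u i <=
  \sum_(s' <= i < t') u i.
Proof.
move=> b0 c0 A0 u0 sg0 usg uA ss st tt tst.
pose P (i : nat) := ~~ ((s <= i) && (i < t))%N.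
have spl (f : nat -> R) : \sum_(s' <= i < t') f i =
    \sum_(s <= i < t) f i + \sum_(s' <= i < t' | P i) f i.
  rewrite (bigID P)/= addrC; congr (_ + _).
  rewrite (@big_cat_nat _ _ _ s s' t')//=; last by lia.
  rewrite (@big_cat_nat _ _ _ t s t')//=; last by lia.
  rewrite big_nat_cond big_pred0 ?add0r; last by move=> i; rewrite /P; lia.
  rewrite [X in _ + X]big_nat_cond [X in _ + X]big_pred0 ?addr0; last first.
    by move=> i; rewrite /P; lia.
  rewrite big_nat_cond [RHS]big_nat; apply: eq_bigl => i; rewrite /P; lia.
set U := \sum_(s' <= i < t') u i.
set E := \sum_(s' <= i < t' | P i) u i.
have U0 : 0 < U by apply: sum_nat_gt0 => //; lia.
have E0 : 0 <= E by apply: sumr_ge0 => i _; exact: ltW.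
have le_SP (f : nat -> R) : (forall i, 0 < f i) ->
    0 <= \sum_(s' <= i < t' | P i) f i <= \sum_(s' <= i < t') f i.
  move=> f0; rewrite spl sumr_ge0//=; last by move=> i _; exact: ltW.
  by rewrite ler_wpDl// sumr_ge0// => i _; exact: ltW.
have half : 2^-1 * (t' - s')%:R <= \sum_(s' <= i < t' | P i) (1 : R).
  have := spl (fun=> 1); rewrite !sumr_const_nat.
  have : (2 * (t - s))%:R <= (t' - s')%:R :> R by rewrite ler_nat.
  rewrite natrM; lra.
have H1 := count_le_weights (index_iota s' t') P b0 c0 u0 sg0 usg.
have H2 := uA s' t' ltac:(lia).
rewrite -/U -/E in H1 H2.
set X := (\sum_(s' <= i < t') sg i) `^ c in H2.
have X0 : 0 < X by rewrite powR_gt0// sum_nat_gt0//; lia.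
have H3 : 2^-1 `^ (b + c) * (t' - s')%:R `^ (b + c) <= E `^ b * X.
  rewrite -powRM// ?invr_ge0//.
  apply: le_trans (_ : (\sum_(s' <= i < t' | P i) 1) `^ (b + c) <= _).
    apply: ge0_ler_powR; rewrite ?nnegrE//; first by lra.
    by apply: sumr_ge0.
  apply: le_trans H1 _; apply: ler_wpM2l; first exact: powR_ge0.
  have /andP[? ?] := le_SP sg sg0.
  by apply: ge0_ler_powR; rewrite ?nnegrE// ?(ltW c0)//; apply: le_trans; eassumption.
have H4 : 2^-1 `^ (b + c) / A * U `^ b <= E `^ b.
  rewrite -(ler_pM2r X0); apply: le_trans H3.
  rewrite -mulrA -mulrA ler_pM2l ?powR_gt0 ?invr_gt0 ?ltr0n//.
  by rewrite -mulrA ler_pdivrMl.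
rewrite [leRHS]spl -/E mulrDl mul1r lerD2l.
apply: (@le_trans _ _ ((2^-1 `^ (b + c) / A) `^ b^-1 * U)).
  apply: ler_wpM2l; first exact: powR_ge0.
  by apply: le_sum_subinterval => //; [move=> i; exact: ltW|exact: ltnW].
have EE z : 0 <= z -> z = (z `^ b) `^ b^-1.
  by move=> z0; rewrite -powRrM mulfV ?powRr1// gt_eqF.
rewrite [leRHS]EE// [U in leLHS]EE ?(ltW U0)// -powRM ?powR_ge0//; last first.
  by rewrite divr_ge0 ?powR_ge0// ltW.
apply: ge0_ler_powR; rewrite ?nnegrE ?invr_ge0 ?powR_ge0 ?(ltW b0)//.
by rewrite mulr_ge0 ?divr_ge0 ?powR_ge0// ltW.
Qed.

(** * Two bounds for a fractional mean *)

Lemma le_powR_inv (R : realType) (x y e : R) :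
  0 < e -> 0 <= x -> 0 <= y -> x `^ e <= y -> x <= y `^ e^-1.
Proof.
move=> e0 x0 y0 xy; rewrite (_ : x = (x `^ e) `^ e^-1).
  by apply: ge0_ler_powR; rewrite ?nnegrE ?powR_ge0 ?invr_ge0 ?(ltW e0).
by rewrite -powRrM mulfV ?powRr1 ?gt_eqF.
Qed.

(** Hoelder for [g * sg = (g^p * sg)^(1/p) * sg^c]; the weight condition then trades [sg(J)^c] for
    [|J|^(b+c) * u(J)^(-b)]. *)
Lemma frac_mean_le_norm (R : realType) (p b A : R) (u sg g : nat -> R)
    (s t L : nat) (c := 1 - p^-1) :
  1 < p -> 0 < A -> (forall i, 0 < u i) -> (forall i, 0 < sg i) ->
  (forall i, 0 <= g i) -> two_weight_bound b c A u sg ->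
  (s < t)%N -> (t <= L)%N ->
  (t - s)%:R `^ (- (b + c)) * \sum_(s <= i < t) g i * sg i <=
  A * (\sum_(0 <= i < L) g i `^ p * sg i) `^ p^-1 *
  (\sum_(s <= i < t) u i) `^ (- b).
Proof.
move=> p1 A0 u0 sg0 g0 uA st tL.
have p0 : 0 < p by lra.
have pV0 : 0 < p^-1 by rewrite invr_gt0.
have pV1 : p^-1 < 1 by rewrite invf_lt1.
have gs0 i : 0 <= g i `^ p * sg i by rewrite mulr_ge0 ?powR_ge0// ltW.
have gE i : (g i `^ p * sg i) `^ p^-1 * sg i `^ c = g i * sg i.
  rewrite powRM ?powR_ge0 ?(ltW (sg0 i))// -powRrM mulfV ?gt_eqF//.
  rewrite powRr1// -mulrA -powRD; last by rewrite (gt_eqF (sg0 i)) implybT.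
  by rewrite /c addrC subrK powRr1// ltW.
have := hoelder_sum (index_iota s t) xpredT pV0 pV1 gs0 (fun i => ltW (sg0 i)).
rewrite -/c; under eq_bigr => i _ do rewrite gE.
set G := \sum_(s <= i < t) _; set Phi := \sum_(s <= i < t) _.
set S := \sum_(s <= i < t) sg i => H.
set U := \sum_(s <= i < t) u i.
have n0 : 0 < (t - s)%:R :> R by rewrite ltr0n subn_gt0.
have U0 : 0 < U by exact: sum_nat_gt0.
have HP : Phi `^ p^-1 <= (\sum_(0 <= i < L) g i `^ p * sg i) `^ p^-1.
  apply: ge0_ler_powR; rewrite ?nnegrE ?(ltW pV0)//; try exact: sumr_ge0.
  by apply: le_sum_subinterval => //; exact: ltnW.
have HU := uA s t st; rewrite -/U -/S in HU.
rewrite !powRN ler_pdivrMl ?powR_gt0//.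
rewrite mulrA ler_pdivlMr ?powR_gt0//.
apply: le_trans (ler_wpM2r (powR_ge0 U b) H) _.
rewrite -mulrA [_ `^ c * _]mulrC.
apply: le_trans (ler_pM _ _ HP HU) _; rewrite ?mulr_ge0 ?powR_ge0//.
by rewrite le_eqVlt; apply/orP; left; apply/eqP; ring.
Qed.

(* Here [m] plays the role of a maximal function of [m1^e / u], [m1] being a
   maximal function of [g] and [p / e = 1 + b / c]; this choice of [e] makes
   the powers of [t - s] cancel. *)
Lemma frac_mean_le_maximal (R : realType) (p b A n U S G m : R)
    (c := 1 - p^-1) (e := p / (1 + b / c)) :
  1 < p -> 0 < b -> 0 < A -> 0 < n -> 0 < U -> 0 < S -> 0 <= G -> 0 <= m ->
  n * G `^ e <= m * U -> U `^ b * S `^ c <= A * n `^ (b + c) ->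
  n `^ (- (b + c)) * (S * G) <= A `^ c^-1 * m `^ e^-1 * U `^ (p^-1 - b).
Proof.
move=> p1 b0 A0 n0 U0 S0 G0 m0 HG HS.
have p0 : 0 < p by lra.
have pV1 : p^-1 < 1 by rewrite invf_lt1.
have c0 : 0 < c by rewrite subr_gt0.
have r0 : 0 < 1 + b / c by rewrite addr_gt0// divr_gt0.
have e0 : 0 < e by rewrite divr_gt0.
(* In the application [G] is the [sg]-mean of [g] over an interval with [n] points, so that [S * G]
   is the sum of [g * sg]. *)
have HG' : G <= (m * U / n) `^ e^-1.
  apply: le_powR_inv => //; first by rewrite divr_ge0 ?mulr_ge0 ?(ltW U0) ?(ltW n0).
  by rewrite ler_pdivlMr// mulrC.
have HS' : S <= (A * n `^ (b + c) / U `^ b) `^ c^-1.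
  apply: le_powR_inv => //; first exact: ltW.
    by rewrite divr_ge0 ?mulr_ge0 ?powR_ge0// ltW.
  by rewrite ler_pdivlMr ?powR_gt0// mulrC.
have := ler_pM (ltW S0) G0 HS' HG'.
rewrite -(ler_pM2l (powR_gt0 (- (b + c)) n0)) => H; apply: le_trans H _.
rewrite -powRN -[n^-1]powR_inv1 ?(ltW n0)//.
rewrite !(powRM, mulr_ge0, powR_ge0, ltW n0, ltW U0, ltW A0)//.
rewrite -!powRrM.
have bp0 := mulr_gt0 b0 p0.
have En : n `^ ((b + c) * c^-1) * n `^ (-1 * e^-1) * n `^ (- (b + c)) = 1.
  rewrite !powR_expR// -!expRD -[RHS]expR0; congr expR.
  rewrite /e /c; field; apply/and3P; split; lra.
have EU : U `^ (- b * c^-1) * U `^ e^-1 = U `^ (p^-1 - b).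
  rewrite !powR_expR// -!expRD; congr expR.
  rewrite /e /c; field; apply/and3P; split; lra.
rewrite -EU le_eqVlt; apply/orP; left; apply/eqP.
transitivity (A `^ c^-1 * m `^ e^-1 * (U `^ (- b * c^-1) * U `^ e^-1) *
  (n `^ ((b + c) * c^-1) * n `^ (-1 * e^-1) * n `^ (- (b + c)))); first by ring.
by rewrite En mulr1.
Qed.

(** * Balls in a window and the Riesz kernel *)

(* The ball of radius [8 ^ n] around [k] in the window [[0, 8 ^ N)] is the
   half-open interval [[ball_lo k n, ball_hi N k n)]. *)
Definition ball_lo (k n : nat) := (k - 8 ^ n)%N.
Definition ball_hi (N k n : nat) := minn (k + 8 ^ n).+1 (8 ^ N).

Lemma ball_nonempty (N k n : nat) : (k < 8 ^ N)%N ->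
  [/\ (ball_lo k n <= k)%N, (k < ball_hi N k n)%N & (ball_hi N k n <= 8 ^ N)%N].
Proof. by rewrite /ball_lo /ball_hi => kN; split; lia. Qed.

(** A ball of radius [8^n] has at most [3 * 8^n] points, while the next one keeps at least [8^(n+1)]
    points after clipping to the window. The ratio 2 is the one required by [weight_growth]. *)
Lemma ball_growth (N k n : nat) : (k < 8 ^ N)%N -> (n < N)%N ->
  [/\ (ball_lo k n.+1 <= ball_lo k n)%N, (ball_hi N k n <= ball_hi N k n.+1)%N &
    (2 * (ball_hi N k n - ball_lo k n) <= ball_hi N k n.+1 - ball_lo k n.+1)%N].
Proof.
move=> kN nN; rewrite /ball_lo /ball_hi.
have n0 : (0 < 8 ^ n)%N by rewrite expn_gt0.
have : (8 ^ n.+1 <= 8 ^ N)%N by rewrite leq_exp2l.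
by rewrite expnS; split; lia.
Qed.

Lemma ball_at_distance (N k i : nat) : (k < 8 ^ N)%N -> (i < 8 ^ N)%N -> i != k ->
  exists n, [/\ (n <= N)%N, (ball_lo k n <= i < ball_hi N k n)%N &
    (ball_hi N k n - ball_lo k n <= 24 * `|k - i|)%N].
Proof.
move=> kN iN ik.
pose Q n := (`|k - i| <= 8 ^ n)%N.
have QN : Q N by rewrite /Q; lia.
case: (ex_minnP (ex_intro Q N QN)) => n Qn nmin.
exists n; split; first exact: nmin.
  by move: Qn; rewrite /Q /ball_lo /ball_hi; lia.
have : (8 ^ n <= 8 * `|k - i|)%N.
  case: n Qn nmin => [|n] Qn nmin; first by rewrite expn0; lia.
  have : ~~ Q n by apply/negP => /nmin; rewrite ltnn.
  by rewrite /Q expnS; lia.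
have n0 : (0 < 8 ^ n)%N by rewrite expn_gt0.
by rewrite /ball_lo /ball_hi; lia.
Qed.

(** Each [i] is charged to the ball given by [ball_at_distance], whose size is comparable to
    [|k - i|]; the remaining balls only add nonnegative terms, and the two sums are exchanged. *)
Lemma riesz_le_ball_sum (R : realType) (th : R) (f : nat -> R) (N k : nat) :
  0 < th -> (forall i, 0 <= f i) -> (k < 8 ^ N)%N ->
  \sum_(0 <= i < 8 ^ N | i != k) f i * `|k - i|%N%:R `^ (- th) <=
  24 `^ th * \sum_(0 <= n < N.+1) (ball_hi N k n - ball_lo k n)%:R `^ (- th) *
     \sum_(ball_lo k n <= i < ball_hi N k n) f i.
Proof.
move=> th0 f0 kN.
pose c n : R := (ball_hi N k n - ball_lo k n)%:R `^ (- th).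
pose J n i := (ball_lo k n <= i < ball_hi N k n)%N.
have c0 n : 0 <= c n by exact: powR_ge0.
have pt i : (i < 8 ^ N)%N -> i != k ->
    f i * `|k - i|%N%:R `^ (- th) <=
    24 `^ th * \sum_(0 <= n < N.+1 | J n i) c n * f i.
  move=> iN ik; have [n [nN nJ nd]] := ball_at_distance kN iN ik.
  have [lok khi _] := ball_nonempty n kN.
  have b0 : 0 < (ball_hi N k n - ball_lo k n)%:R :> R.
    by rewrite ltr0n subn_gt0 (leq_ltn_trans lok).
  have d0 : 0 < `|k - i|%N%:R :> R by rewrite ltr0n; lia.
  apply: le_trans (_ : 24 `^ th * (c n * f i) <= _); last first.
    rewrite ler_wpM2l ?powR_ge0// big_mkcond (bigD1_seq n _ (iota_uniq _ _))/=.
      rewrite /J nJ lerDl sumr_ge0// => j _; case: ifP => // _.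
      by rewrite mulr_ge0.
    by rewrite in_cons mem_iota; lia.
  rewrite mulrA mulrC ler_wpM2r// /c !powRN.
  rewrite -[leLHS]mul1r ler_pdivrMr ?powR_gt0// mulrAC ler_pdivlMr ?powR_gt0//.
  rewrite mul1r -powRM//.
  apply: ge0_ler_powR; rewrite ?nnegrE ?(ltW th0) ?mulr_ge0//.
  by rewrite -natrM ler_nat.
apply: le_trans
  (_ : \sum_(0 <= i < 8 ^ N) 24 `^ th * \sum_(0 <= n < N.+1 | J n i) c n * f i <= _).
  rewrite big_mkcond big_nat [leRHS]big_nat; apply: ler_sum => i /andP[_ iN].
  case: ifP => [ik|_]; first exact: pt.
  by rewrite mulr_ge0 ?powR_ge0 ?sumr_ge0// => n _; rewrite mulr_ge0.
rewrite -mulr_sumr ler_wpM2l ?powR_ge0//.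
under eq_bigr do rewrite big_mkcond/=.
rewrite exchange_big/= le_eqVlt; apply/orP; left; apply/eqP.
apply: eq_bigr => n _; rewrite -/(c n) mulr_sumr.
have [_ _ hiN] := ball_nonempty n kN.
rewrite (big_nat_widen _ _ _ _ _ hiN) [RHS](big_nat_widenl _ _ _ _ _ (leq0n _)).
by rewrite [RHS]big_mkcond/=; apply: eq_bigr => i _; rewrite /J andbC.
Qed.

(** * Hedberg's argument on one window *)

(** Here [b] stands for [1/q]. The constant is fixed before the window and the weights, so the bound
    survives translation and enlargement of the window. *)
Lemma riesz_window_bound (R : realType) (p b A : R) :
  1 < p -> 0 < b -> b < p^-1 -> 0 < A ->
  exists2 K : R, 0 < K &
  forall (N : nat) (u sg g : nat -> R),
    (forall i, 0 < u i) -> (forall i, 0 < sg i) -> (forall i, 0 <= g i) ->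
    (forall i, u i `^ b * sg i `^ (1 - p^-1) = 1) ->
    two_weight_bound b (1 - p^-1) A u sg ->
  \sum_(0 <= k < 8 ^ N)
    (\sum_(0 <= i < 8 ^ N | i != k)
       g i * sg i * `|k - i|%N%:R `^ (- (b + (1 - p^-1)))) `^ b^-1 * u k
  <= K * (\sum_(0 <= i < 8 ^ N) g i `^ p * sg i) `^ (p * b)^-1.
Proof.
move=> p1 b0 bp A0; set c := 1 - p^-1.
have p0 : 0 < p by lra.
have pV0 : 0 < p^-1 by rewrite invr_gt0.
have pV1 : p^-1 < 1 by rewrite invf_lt1.
have c0 : 0 < c by rewrite subr_gt0.
have th0 : 0 < b + c by rewrite addr_gt0.
(* This [r] gives [u^(-r) * u = sg], and [e = p / r] then gives [(m1^e / u)^r * u = m1^p * sg]: the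
   second maximal function is controlled by the first. *)
pose r := 1 + b / c.
have r1 : 1 < r by rewrite ltrDl divr_gt0.
pose e := p / r.
have r0 : 0 < r by lra.
have e0 : 0 < e by rewrite divr_gt0.
pose a := p^-1 - b.
have a0 : 0 < a by rewrite subr_gt0.
(* After raising to the power [1/b], [m2] carries the exponent [r] and [Phi] the exponent [a / b];
   the maximal bound supplies one more factor [Phi]. *)
have E1 : e^-1 * (b / p^-1) * b^-1 = r by rewrite /e; field; apply/and3P; split; lra.
have E2 : p^-1 * (a / p^-1) * b^-1 = a / b by field; apply/andP; split; lra.
have E3 : a / b + 1 = (p * b)^-1 by rewrite /a; field; apply/andP; split; lra.
have [C1 C10 max1] := maximal_le p1.
have [C2 C20 max2] := maximal_le r1.
pose rho := 1 + (2^-1 `^ (b + c) / A) `^ b^-1.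
have rho1 : 1 < rho by rewrite ltrDl powR_gt0// divr_gt0// powR_gt0// invr_gt0.
have [K1 K10 HK] := sum_min_powR a0 b0 rho1.
have ab : a + b = p^-1 by rewrite subrK.
rewrite ab in HK.
pose D := 24 `^ (b + c) * (K1 * ((A `^ c^-1) `^ (b / p^-1) * A `^ (a / p^-1))).
have D0 : 0 < D by rewrite !mulr_gt0 ?powR_gt0.
exists (D `^ b^-1 * (C2 * C1)); first by rewrite !mulr_gt0 ?powR_gt0.
move=> N u sg g u0 sg0 g0 usg uA.
set L := (8 ^ N)%N.
have [m1 [m10 m1J m1p]] := max1 L sg g sg0 g0.
have [m2 [m20 m2J m2r]] := max2 L u (fun i => m1 i `^ e / u i) u0
  (fun i => divr_ge0 (powR_ge0 _ _) (ltW (u0 i))).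
set Phi := \sum_(0 <= i < L) g i `^ p * sg i.
have Phi0 : 0 <= Phi.
  by apply: sumr_ge0 => i _; rewrite mulr_ge0 ?powR_ge0// ltW.
have usg' i : u i `^ (- r) * u i = sg i.
  have : ln (u i `^ b * sg i `^ c) = 0 by rewrite usg ln1.
  rewrite lnM ?posrE ?powR_gt0// !ln_powR => E.
  rewrite powR_expR// -[X in _ * X]lnK ?posrE// -expRD -[RHS]lnK ?posrE//.
  congr expR; rewrite /r.
  have -> : - (1 + b / c) * ln (u i) + ln (u i) = - (b * ln (u i)) / c.
    by field; lra.
  have -> : b * ln (u i) = - (c * ln (sg i)) by lra.
  by field; lra.
have m2_le : \sum_(0 <= k < L) m2 k `^ r * u k <= C2 * (C1 * Phi).
  apply: le_trans m2r _; rewrite ler_pM2l//; apply: le_trans m1p.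
  rewrite le_eqVlt; apply/orP; left; apply/eqP; apply: eq_bigr => i _.
  rewrite powRM ?powR_ge0 ?invr_ge0 ?(ltW (u0 i))// -powRrM divfK ?gt_eqF//.
  by rewrite -[(u i)^-1]powR_inv1 ?(ltW (u0 i))// -powRrM mulN1r -mulrA usg'.
have pt k : (k < L)%N ->
    (\sum_(0 <= i < L | i != k)
       g i * sg i * `|k - i|%N%:R `^ (- (b + c))) `^ b^-1 <=
    D `^ b^-1 * (m2 k `^ r * Phi `^ (a / b)).
  move=> kL.
  have gs0 i : 0 <= g i * sg i by rewrite mulr_ge0// ltW.
  have HT := riesz_le_ball_sum th0 gs0 kL.
  have HS : \sum_(0 <= n < N.+1) (ball_hi N k n - ball_lo k n)%:R `^ (- (b + c)) *
      \sum_(ball_lo k n <= i < ball_hi N k n) g i * sg i <=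
      K1 * ((A `^ c^-1 * m2 k `^ e^-1) `^ (b / p^-1) *
            (A * Phi `^ p^-1) `^ (a / p^-1)).
    (* The geometric parameter is the [u]-mass of the ball, not its radius; its growth comes from
       [weight_growth]. *)
    apply: (HK N (fun n => \sum_(ball_lo k n <= i < ball_hi N k n) u i)).
    - by rewrite mulr_ge0 ?powR_ge0.
    - by rewrite mulr_ge0 ?powR_ge0// ltW.
    - move=> n; have [lok khi _] := ball_nonempty n kL.
      by apply: sum_nat_gt0 => //; exact: leq_ltn_trans khi.
    - move=> n nN; have [lok khi _] := ball_nonempty n kL.
      have [h1 h2 h3] := ball_growth kL nN.
      apply: (weight_growth b0 c0 A0 u0 sg0 usg uA) => //.
      exact: leq_ltn_trans khi.
    move=> n nN; have [lok khi hiL] := ball_nonempty n kL.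
    set s := ball_lo k n in lok *; set t := ball_hi N k n in khi hiL *.
    have st : (s < t)%N by exact: leq_ltn_trans khi.
    have n0 : 0 < (t - s)%:R :> R by rewrite ltr0n subn_gt0.
    set U := \sum_(s <= i < t) u i; have U0 : 0 < U by exact: sum_nat_gt0.
    pose S := \sum_(s <= i < t) sg i; have S0 : 0 < S by exact: sum_nat_gt0.
    set f := \sum_(s <= i < t) g i * sg i.
    have f0 : 0 <= f by apply: sumr_ge0.
    split.
    - by rewrite mulr_ge0 ?powR_ge0.
    - rewrite (_ : f = S * (f / S)); last by rewrite mulrC divfK ?gt_eqF.
      apply: (frac_mean_le_maximal p1 b0 A0 n0 U0 S0) => //.
      + by rewrite divr_ge0// ltW.
      + have := m2J s k t lok khi hiL.
        rewrite (eq_bigr (fun i => m1 i `^ e)); last first.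
          by move=> i _; rewrite divfK ?gt_eqF.
        move=> H; apply: le_trans H.
        (* At every point of the ball [m1] dominates the [sg]-mean [f / S], so the constant
           [(f / S)^e] can be summed against [m1^e]. *)
        rewrite -/r -/e (_ : _ * _ = \sum_(s <= i < t) (f / S) `^ e); last first.
          by rewrite sumr_const_nat mulr_natl.
        rewrite [leLHS]big_nat [leRHS]big_nat; apply: ler_sum => j /andP[sj jt].
        apply: ge0_ler_powR; rewrite ?nnegrE ?(ltW e0) ?divr_ge0 ?(ltW S0)//.
        by rewrite ler_pdivrMr// m1J.
      + exact: uA.
    - exact: (frac_mean_le_norm p1 A0 u0 sg0 g0 uA st hiL).
  have {HT HS} := le_trans HT (ler_wpM2l (powR_ge0 _ _) HS).
  set T := (X in X <= _) => HT.
  have T0 : 0 <= T.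
    by apply: sumr_ge0 => i _; rewrite mulr_ge0 ?powR_ge0.
  have -> : m2 k `^ r * Phi `^ (a / b) =
     ((m2 k `^ e^-1) `^ (b / p^-1) * (Phi `^ p^-1) `^ (a / p^-1)) `^ b^-1.
    rewrite [RHS](powRM _ (powR_ge0 _ _) (powR_ge0 _ _)).
    by rewrite -!(powRrM (m2 k)) -!(powRrM Phi) E1 E2.
  rewrite -powRM ?mulr_ge0 ?powR_ge0 ?(ltW D0) ?(ltW K10)//.
  apply: ge0_ler_powR; rewrite ?nnegrE ?invr_ge0 ?(ltW b0)//.
    by rewrite (mulr_ge0 (ltW D0))// mulr_ge0 ?powR_ge0.
  apply: le_trans HT _; rewrite !powRM ?powR_ge0 ?(ltW A0) ?(ltW K10)//.
  by rewrite mulrACA /D -!mulrA.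
apply: le_trans (_ : \sum_(0 <= k < L)
    D `^ b^-1 * Phi `^ (a / b) * (m2 k `^ r * u k) <= _).
  rewrite [leLHS]big_nat [leRHS]big_nat; apply: ler_sum => k /andP[_ kL].
  apply: le_trans (ler_wpM2r (ltW (u0 k)) (pt k kL)) _.
  by rewrite le_eqVlt; apply/orP; left; apply/eqP; ring.
rewrite -mulr_sumr.
apply: le_trans (ler_wpM2l _ m2_le) _; first by rewrite mulr_ge0 ?powR_ge0.
have -> : Phi `^ (p * b)^-1 = Phi `^ (a / b) * Phi.
  rewrite -[X in _ = _ * X]powRr1// -powRD; last first.
    by apply/implyP; rewrite gt_eqF// addr_gt0 ?divr_gt0.
  by rewrite E3.
by rewrite le_eqVlt; apply/orP; left; apply/eqP; ring.
Qed.

(** * From windows to finite sets of integers *)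

Lemma le_sum_uniq_subset (R : numDomainType) (T : eqType) (s1 s2 : seq T)
    (P : pred T) (f : T -> R) :
  uniq s1 -> uniq s2 -> {subset s1 <= s2} -> (forall i, 0 <= f i) ->
  \sum_(i <- s1 | P i) f i <= \sum_(i <- s2 | P i) f i.
Proof.
move=> u1 u2 s12 f0.
rewrite (perm_big [seq i <- s2 | i \in s1]); last first.
  apply: uniq_perm => //; first exact: filter_uniq.
  by move=> i; rewrite mem_filter andb_idr//; exact: s12.
rewrite big_filter_cond [leRHS](bigID (mem s1))/=.
rewrite [X in _ <= X + _](eq_bigl (fun i => (i \in s1) && P i)); last first.
  by move=> i; rewrite andbC.
by rewrite lerDl sumr_ge0.
Qed.

(** The supremum runs over all intervals, so a single [A] serves every base point [a]. *)
Lemma Apq_two_weight_bound (R : realType) (p q : R) (w : int -> R) :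
  1 < p -> 0 < q -> weight w -> Apq p q w ->
  exists2 A : R, 0 < A & forall a : int,
    two_weight_bound q^-1 (1 - p^-1) A
      (fun i => wpow w q (a + i%:Z)) (fun i => wpow w (- conj_exp p) (a + i%:Z)).
Proof.
move=> p1 q0 w0; rewrite /Apq; set E := ereal_sup _ => Eoo.
have cE : (conj_exp p)^-1 = 1 - p^-1 by rewrite /conj_exp; field; apply/andP; split; lra.
have [A HA] : exists A : R, (E <= A%:E)%E.
  move: Eoo; case: (E) => [r _|//|_]; first by exists r.
  by exists 0; rewrite leNye.
exists (`|A| + 1); first by rewrite ltr_wpDl.
move=> a s t st.
(* [interval_mean] takes the cardinality minus one, hence [(t - s).-1]. *)
have : (((interval_mean (wpow w q) (a + s%:Z) (t - s).-1) `^ q^-1 *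
         (interval_mean (wpow w (- conj_exp p)) (a + s%:Z) (t - s).-1)
           `^ (conj_exp p)^-1)%:E <= A%:E)%E.
  apply: le_trans HA; apply: ereal_sup_ubound.
  by exists (a + s%:Z, (t - s).-1).
rewrite lee_fin cE.
have mE (f : int -> R) : interval_mean f (a + s%:Z) (t - s).-1 =
    (t - s)%:R^-1 * \sum_(s <= i < t) f (a + i%:Z).
  rewrite /interval_mean prednK ?subn_gt0//; congr (_ * _).
  rewrite -[X in _ = \sum_(X <= i < t) _]add0n big_addn big_mkord; apply: eq_bigr => i _.
  by congr f; rewrite PoszD; ring.
rewrite !mE.
have n0 : 0 < (t - s)%:R :> R by rewrite ltr0n subn_gt0.
have S0 (f : int -> R) : (forall i, 0 <= f i) ->
    0 <= \sum_(s <= i < t) f (a + i%:Z) by move=> f0; exact: sumr_ge0.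
rewrite !powRM ?invr_ge0 ?(ltW n0) ?S0//; try by move=> i; exact: powR_ge0.
rewrite mulrACA -powRD; last by rewrite invr_eq0 (gt_eqF n0) implybT.
rewrite -[(t - s)%:R^-1]powR_inv1 ?(ltW n0)// -powRrM mulN1r powRN.
rewrite ler_pdivrMl ?powR_gt0// [leRHS]mulrC => H; apply: le_trans H _.
rewrite ler_wpM2r ?powR_ge0//; have := ler_norm A; lra.
Qed.

(** All terms are nonnegative, so the finite set may be enlarged to a translated window, where
    [riesz_window_bound] applies. *)
Lemma riesz_finite_bound (R : realType) (p q : R) (w : int -> R) :
  1 < p -> 0 < q -> q^-1 < p^-1 -> weight w -> Apq p q w ->
  exists2 K : R, 0 < K &
  forall (f : int -> R) (X : R), (forall i, 0 <= f i) ->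
    (forall s : seq int, uniq s -> \sum_(i <- s) (f i * w i) `^ p <= X) ->
  forall s : seq int, uniq s ->
  \sum_(k <- s) (\sum_(i <- s | i != k)
      f i / `|k - i|%:~R `^ (q^-1 + (1 - p^-1))) `^ q * w k `^ q
  <= K * X `^ (q / p).
Proof.
move=> p1 q0 qp w0 wA.
have [A A0 HA] := Apq_two_weight_bound p1 q0 w0 wA.
have qV0 : 0 < q^-1 by rewrite invr_gt0.
have [K K0 HK] := riesz_window_bound p1 qV0 qp A0.
exists K => // f X f0 fX s us.
have [M sM] : exists M : nat, forall z, z \in s -> (`|z| < M)%N.
  exists (\sum_(z <- s) `|z|).+1 => z zs.
  by rewrite ltnS (bigD1_seq z)//= leq_addr.
(* Any [N] with [2 * M <= 8^N] makes the window starting at [- M] contain [s]. *)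
set N := (2 * M)%N.
have N8 : (2 * M < 8 ^ N)%N by rewrite /N; apply: ltn_expl.
pose win := [seq - M%:Z + j%:Z | j <- index_iota 0 (8 ^ N)].
have uwin : uniq win by rewrite map_inj_uniq ?iota_uniq// => i j /addrI[].
have swin : {subset s <= win}.
  move=> z zs; apply/mapP; have := sM z zs => zM.
  exists (absz (z + M%:Z)); last by lia.
  by rewrite mem_index_iota; lia.
set th := q^-1 + (1 - p^-1).
have inner0 s' k : 0 <= \sum_(i <- s' | i != k) f i / `|k - i|%:~R `^ th.
  by apply: sumr_ge0 => i _; rewrite divr_ge0// powR_ge0.
apply: le_trans (_ : \sum_(k <- win) (\sum_(i <- win | i != k)
    f i / `|k - i|%:~R `^ th) `^ q * w k `^ q <= _).
  apply: le_trans (le_sum_uniq_subset xpredT us uwin swin _); last first.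
    by move=> k; rewrite mulr_ge0 ?powR_ge0.
  apply: ler_sum => k _; rewrite ler_wpM2r ?powR_ge0//.
  apply: ge0_ler_powR; rewrite ?nnegrE ?(ltW q0)//.
  apply: le_sum_uniq_subset => // i; rewrite divr_ge0// powR_ge0.
pose v (j : nat) := w (- M%:Z + j%:Z).
pose u j := v j `^ q; pose sg j := v j `^ (- conj_exp p).
(* Chosen so that [g * sg = f] and, since [p' * (p - 1) = p], [g^p * sg = (f * w)^p]. *)
pose g j := f (- M%:Z + j%:Z) / sg j.
have v0 j : 0 < v j by exact: w0.
have u0 j : 0 < u j by exact: powR_gt0.
have sg0 j : 0 < sg j by exact: powR_gt0.
have g0 j : 0 <= g j by rewrite divr_ge0// ltW.
have pp : conj_exp p * (1 - p^-1) = 1.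
  by rewrite /conj_exp; field; apply/andP; split; lra.
have usg j : u j `^ q^-1 * sg j `^ (1 - p^-1) = 1.
  rewrite /u /sg -!powRrM mulfV ?gt_eqF// mulNr pp -powRD ?subrr ?powRr0//.
  by rewrite (gt_eqF (v0 j)) implybT.
have := HK N u sg g u0 sg0 g0 usg (HA _).
have gp j : g j `^ p * sg j = (f (- M%:Z + j%:Z) * v j) `^ p.
  rewrite /g !powRM ?invr_ge0 ?(ltW (sg0 j)) ?(ltW (v0 j))// -mulrA; congr (_ * _).
  rewrite /sg -powRN -powRrM -powRD; last by rewrite (gt_eqF (v0 j)) implybT.
  by congr powR; rewrite /conj_exp; field; lra.
rewrite invrK (eq_bigr _ (fun j _ => gp j)).
have -> : (p * q^-1)^-1 = q / p by field; apply/andP; split; lra.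
move=> H; apply: le_trans (le_trans H _).
  rewrite le_eqVlt; apply/orP; left; apply/eqP.
  rewrite big_map; apply: eq_bigr => k _; congr (_ `^ _ * _).
  rewrite big_map; apply: eq_big => [i|i _].
    by rewrite (inj_eq (addrI _)).
  rewrite /g divfK ?gt_eqF// powRN; congr (_ / _ `^ _).
  by rewrite opprD addrACA subrr add0r -abszE.
rewrite ler_pM2l//; apply: ge0_ler_powR; rewrite ?nnegrE.
- by rewrite divr_ge0// ltW//; lra.
- by apply: sumr_ge0 => j _; exact: powR_ge0.
- by have := fX [::] isT; rewrite big_nil.
- by have := fX win uwin; rewrite big_map.
Qed.

(** * Infinite sums and their finite partial sums *)

(** Half of a positive finite supremum is not an upper bound, so some partial sum exceeds it. The
    factor 2 replaces a limit by one finite set. *)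
Lemma le_fine_esum_finite (R : realType) (T : choiceType) (D : set T) (f : T -> R) :
  (forall i, 0 <= f i) -> (\esum_(i in D) (f i)%:E < +oo)%E ->
  exists s : seq T, [/\ uniq s, forall i, i \in s -> D i &
    fine (\esum_(i in D) (f i)%:E)%E <= 2 * \sum_(i <- s) f i].
Proof.
move=> f0 foo; set S := esum _ _ in foo *.
have S0 : (0 <= S)%E by apply: esum_ge0 => i _; rewrite lee_fin.
have SE : S = (fine S)%:E by rewrite fineK// ge0_fin_numE.
have [S_0|S_0] := eqVneq (fine S) 0.
  by exists [::]; rewrite S_0 big_nil mulr0.
have Sp : 0 < fine S by rewrite lt_def S_0 fine_ge0.
apply: contrapT => nex.
suff : (S <= (fine S / 2)%:E)%E by rewrite {1}SE lee_fin; lra.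
apply: ge_ereal_sup => _ [F [finF FD] <-].
rewrite fsbig_finite//= sumEFin lee_fin leNgt; apply/negP => h.
apply: nex; exists (finmap.enum_fset (fset_set F)); split; first exact: finmap.fset_uniq.
  by move=> i; rewrite in_fset_set// inE => /FD.
lra.
Qed.

Lemma esum_le_finite (R : realType) (T : choiceType) (D : set T) (f : T -> R) (B : R) :
  (forall s : seq T, uniq s -> (forall i, i \in s -> D i) ->
    \sum_(i <- s) f i <= B) ->
  (\esum_(i in D) (f i)%:E <= B%:E)%E.
Proof.
move=> H; apply: ge_ereal_sup => _ [F [finF FD] <-].
rewrite fsbig_finite//= sumEFin lee_fin H ?finmap.fset_uniq//.
by move=> i; rewrite in_fset_set// inE => /FD.
Qed.

Lemma finite_sum_le_esum (R : realType) (T : choiceType) (D : set T)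
    (f : T -> R) (s : seq T) :
  uniq s -> (forall i, i \in s -> D i) ->
  ((\sum_(i <- s) f i)%:E <= \esum_(i in D) (f i)%:E)%E.
Proof.
move=> us sD; apply: esum_ge; exists [set` s].
  by split; [exact: finite_seq|move=> i; exact: sD].
by rewrite -sumEFin fsbig_seq.
Qed.

Lemma real_sum_norm_le (R : realType) (T : choiceType) (D : set T) (f : T -> R) :
  summable D (EFin \o f) ->
  `|real_sum D f| <= fine (\esum_(i in D) `|f i|%:E)%E.
Proof.
move=> sf; rewrite /real_sum.
set P := (\esum_(i in D) (EFin \o f)^\+ i)%E.
set Q := (\esum_(i in D) (EFin \o f)^\- i)%E.
have P0 : (0 <= P)%E by exact: esum_ge0.
have Q0 : (0 <= Q)%E by exact: esum_ge0.
have PQ : (\esum_(i in D) `|f i|%:E = P + Q)%E.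
  by rewrite -esumD//; apply: eq_esum => i _;
     rewrite -[RHS]/(((EFin \o f)^\+ \+ (EFin \o f)^\-)%E i) -fune_abse.
have PQoo : (P + Q < +oo)%E by rewrite -PQ.
have Pf : P \is a fin_num.
  by rewrite ge0_fin_numE//; apply: le_lt_trans PQoo; rewrite leeDl.
have Qf : Q \is a fin_num.
  by rewrite ge0_fin_numE//; apply: le_lt_trans PQoo; rewrite leeDr.
rewrite PQ fineB// fineD//.
apply: le_trans (ler_normB _ _) _.
by rewrite !ger0_norm ?fine_ge0.
Qed.

(** * Passage to infinite sequences *)

Theorem theorem4p4 (R : realType) (alpha p q : R) (w : int -> R)
    (halpha0 : 0 < alpha) (halpha1 : alpha < 1)
    (hp1 : 1 < p) (hp : p < 1 / alpha)
    (hq : 1 / q = 1 / p - alpha)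
    (hw : weight w) (hA : Apq p q w) :
  exists C : R, 0 < C /\
    forall x : int -> R, lp_space p (wpow w p) x ->
      [/\ riesz_defined alpha x,
          lp_space q (wpow w q) (riesz_potential alpha x) &
          ((\esum_(k in [set: int])
               (`|riesz_potential alpha x k * w k| `^ q)%:E) `^ (1 / q)
           <= C%:E *
              (\esum_(k in [set: int]) (`|x k * w k| `^ p)%:E) `^ (1 / p))%E].
Proof.
have p0 : 0 < p by lra.
rewrite !div1r in hq *.
have qV0 : 0 < q^-1.
  by rewrite hq subr_gt0 -[alpha]invrK ltf_pV2 ?posrE ?invr_gt0// -div1r.
have q0 : 0 < q by rewrite -invr_gt0.
have qp : q^-1 < p^-1 by rewrite hq; lra.
have th : q^-1 + (1 - p^-1) = 1 - alpha by rewrite hq; ring.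
have [K K0 HK] := riesz_finite_bound hp1 q0 qp hw hA.
rewrite th in HK.
(* The factor [2^q] pays for replacing each potential by twice a finite partial sum. *)
pose Q := 2 `^ q * K.
have Q0 : 0 < Q by rewrite mulr_gt0 ?powR_gt0.
exists (Q `^ q^-1); split; first exact: powR_gt0.
move=> x; rewrite /lp_space/= /lp_norm => hx.
have normw r (y : int -> R) k : `|y k| `^ r * wpow w r k = `|y k * w k| `^ r.
  by rewrite /wpow normrM (ger0_norm (ltW (hw k))) powRM// ltW.
have {hx} Xoo : (\esum_(k in [set: int]) (`|x k * w k| `^ p)%:E < +oo)%E.
  rewrite (eq_esum (fun k _ => congr1 EFin (esym (normw p x k)))).
  by apply: lty_poweRy hx; rewrite gt_eqF// invr_gt0.
set X := esum _ _ in Xoo *.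
have X0 : (0 <= X)%E by apply: esum_ge0 => k _; rewrite lee_fin powR_ge0.
have XE : X = (fine X)%:E by rewrite fineK// ge0_fin_numE.
have fX (s : seq int) : uniq s -> \sum_(i <- s) (`|x i| * w i) `^ p <= fine X.
  move=> us; rewrite -lee_fin -XE.
  have := @finite_sum_le_esum R int setT (fun k => `|x k * w k| `^ p) s us (fun _ _ => I).
  apply: le_trans; rewrite lee_fin le_eqVlt; apply/orP; left; apply/eqP.
  by apply: eq_bigr => i _; rewrite normrM (ger0_norm (ltW (hw i))).
have {}HK := HK (fun i => `|x i|) (fine X) (fun i => normr_ge0 _) fX.
set B := K * _ in HK.
pose a k i : R := `|x i| / `|k - i|%:~R `^ (1 - alpha).
have a0 k i : 0 <= a k i by rewrite divr_ge0 ?powR_ge0.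
have aE k i : `|riesz_term alpha x k i| = a k i.
  by rewrite /riesz_term normrM normfV (ger0_norm (powR_ge0 _ _)).
have sum0 (P : pred int) k s : 0 <= \sum_(i <- s | P i) a k i by exact: sumr_ge0.
(* Absolute convergence: in the finite bound for [k :: s] only the outer term at [k] is kept, which
   bounds all partial sums by [(B / w k^q)^(1/q)]. *)
have def k : (\esum_(i in ~` [set k]) (a k i)%:E < +oo)%E.
  apply: (@le_lt_trans _ _ ((B / w k `^ q) `^ q^-1)%:E); last exact: ltry.
  apply: esum_le_finite => s us sD.
  have ks : k \notin s by apply/negP => /sD; apply.
  apply: (le_powR_inv q0 (sum0 xpredT k s)).
    rewrite divr_ge0 ?powR_ge0//; apply: le_trans (HK [::] isT).
    by rewrite big_nil.
  rewrite ler_pdivlMr ?powR_gt0//.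
  have := HK (k :: s); rewrite /= ks us => /(_ isT); apply: le_trans.
  have -> : \sum_(i <- s) a k i = \sum_(i <- k :: s | i != k) a k i.
    rewrite big_cons eqxx/= [LHS]big_seq [RHS]big_seq_cond.
    by apply: eq_bigl => i; rewrite andb_idr//; apply: contraTneq => ->.
  rewrite [leRHS]big_cons lerDl sumr_ge0// => j _.
  by rewrite mulr_ge0 ?powR_ge0.
have rdef : riesz_defined alpha x.
  move=> k; rewrite /summable (eq_esum (_ : forall i, _ -> _ = (a k i)%:E))//.
  by move=> i _; rewrite /= aE.
have Ile k : `|riesz_potential alpha x k| <= fine (\esum_(i in ~` [set k]) (a k i)%:E)%E.
  apply: le_trans (real_sum_norm_le (rdef k)) _.
  by rewrite (eq_esum (fun i _ => congr1 EFin (aE k i))).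
have /choice[T HT] : forall k, exists t : seq int,
    [/\ uniq t, forall i, i \in t -> i <> k &
      `|riesz_potential alpha x k| <= 2 * \sum_(i <- t) a k i].
  move=> k; have [t [ut tk tle]] := le_fine_esum_finite (a0 k) (def k).
  by exists t; split => //; exact: le_trans (Ile k) tle.
have bound : (\esum_(k in [set: int])
    (`|riesz_potential alpha x k * w k| `^ q)%:E <= (2 `^ q * B)%:E)%E.
  apply: esum_le_finite => s us _.
  (* One finite set containing the outer indices and every [T k], so that a single use of the finite
     bound covers all of them. *)
  pose W := undup (s ++ flatten (map T s)).
  have uW : uniq W by exact: undup_uniq.
  apply: le_trans (ler_wpM2l (powR_ge0 _ _) (HK W uW)).
  apply: (@le_trans _ _ (\sum_(k <- s) 2 `^ q *
      ((\sum_(i <- W | i != k) a k i) `^ q * w k `^ q))).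
    rewrite big_seq [leRHS]big_seq; apply: ler_sum => k ks.
    have [uT Tk Tle] := HT k.
    rewrite normrM (ger0_norm (ltW (hw k))) powRM// ?(ltW (hw k))//.
    rewrite mulrA ler_wpM2r ?powR_ge0// -powRM//.
    apply: ge0_ler_powR; rewrite ?nnegrE ?(ltW q0) ?mulr_ge0//.
    apply: le_trans Tle _; rewrite ler_pM2l//.
    rewrite big_seq (eq_bigl (fun i => (i \in T k) && (i != k))); last first.
      by move=> i; rewrite andb_idr// => /Tk /eqP.
    rewrite -big_seq_cond; apply: le_sum_uniq_subset => // i iT.
    rewrite mem_undup mem_cat; apply/orP; right; apply/flattenP.
    by exists (T k) => //; exact: map_f.
  rewrite -mulr_sumr ler_wpM2l ?powR_ge0//.
  apply: le_sum_uniq_subset => //.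
    by move=> k ks; rewrite mem_undup mem_cat ks.
  by move=> k; rewrite mulr_ge0 ?powR_ge0.
split=> //.
  apply: poweR_lty; rewrite (eq_esum (fun k _ => congr1 EFin (normw q _ k))).
  exact: le_lt_trans bound (ltry _).
have E0 : (0 <= \esum_(k in [set: int])
    (`|riesz_potential alpha x k * w k| `^ q)%:E)%E.
  by apply: esum_ge0 => k _; rewrite lee_fin powR_ge0.
apply: (@le_trans _ _ ((2 `^ q * B)%:E `^ q^-1)%E).
  apply: gt0_ler_poweR; rewrite ?(ltW qV0)//.
  - by rewrite in_itv/= E0 leey.
  - by rewrite in_itv/= leey andbT; exact: le_trans E0 bound.
rewrite [X in (_ <= _ * X `^ _)%E]XE !poweR_EFin -EFinM lee_fin /B mulrA.
rewrite powRM ?(ltW Q0) ?powR_ge0// -powRrM -/Q.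
by rewrite (_ : q / p * q^-1 = p^-1)//; field; apply/andP; split; lra.
Qed.
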